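(* Let $A$ be a finite-dimensional associative unital algebra over a field $K$. Then $A$ is a Frobenius algebra if and only if there exists a coassociative counital comultiplication $\delta\colon A\to A\otimes A$ which is a map of left $A^e$-modules.
   Context: All tensor products are over $K$. $A$ need not be commutative. $A$ is a Frobenius algebra if there is an isomorphism of left $A$-modules $\lambda_L\colon A\to A^*$, where $A$ is the left regular module, $A^*$ is the $K$-linear dual, and the left action on $A^*$ is $(a\cdot\zeta)(b):=\zeta(ba)$ for $a,b\in A$, $\zeta\in A^*$. $A^e:=A\otimes A^{\mathrm{op}}$. $A$ is a left $A^e$-module via $(b\otimes b')\cdot a:=bab'$, and $A\otimes A$ is a left $A^e$-module via $(b\otimes b')\cdot(x\otimes y):=bx\otimes yb'$. A $K$-linear map $\delta\colon A\to A\otimes A$ is coassociative if $(\delta\otimes \mathrm{id})\circ\delta=(\mathrm{id}\otimes\delta)\circ\delta$, and counital if there is a $K$-linear map $\epsilon\colon A\to K$ with $(\epsilon\otimes\mathrm{id})\circ\delta=\mathrm{id}_A=(\mathrm{id}\otimes\epsilon)\circ\delta$ (identifying $K\otimes A=A=A\otimes K$). *)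

(* Defs.v *)
From HB Require Import structures.
From mathcomp Require Import all_boot all_order all_algebra falgebra.

Set Implicit Arguments.
Unset Strict Implicit.
Unset Printing Implicit Defensive.

Import GRing.Theory.
Local Open Scope ring_scope.

Reserved Notation "U ⊗ V" (at level 40, left associativity).

(* Finite-dimensional associative unital algebras. Contrary to [falgType], the *)
(* zero algebra is allowed; the structure extends [vectType] because Hierarchy *)
(* Builder cannot insert a structure with possibly trivial rings below         *)
(* [lalgType].                                                                 *)
HB.mixin Record Vector_isFinDimAlgebra (K : fieldType) A of Vector K A := {
  fdone : A;
  fdmul : A -> A -> A;
  fdmulA : associative fdmul;
  fdmul1l : left_id fdone fdmul;
  fdmul1r : right_id fdone fdmul;
  fdmulPl : forall y, linear (fdmul^~ y);
  fdmulPr : forall x, linear (fdmul x)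
}.

#[short(type="finDimAlgType")]
HB.structure Definition FinDimAlgebra (K : fieldType) :=
  { A of Vector_isFinDimAlgebra K A & Vector K A }.

Section FinDimAlgebraRing.
Variables (K : fieldType) (A : finDimAlgType K).

Lemma fdmulDl : left_distributive (@fdmul K A) +%R.
Proof. by move=> x y z; have := fdmulPl z 1 x y; rewrite !scale1r. Qed.

Lemma fdmulDr : right_distributive (@fdmul K A) +%R.
Proof. by move=> x y z; have := fdmulPr x 1 y z; rewrite !scale1r. Qed.

HB.instance Definition _ := GRing.Zmodule_isPzRing.Build (FinDimAlgebra.sort A)
  fdmulA fdmul1l fdmul1r fdmulDl fdmulDr.

Lemma fdscaleAl (k : K) (x y : A) : k *: (x * y) = (k *: x) * y.
Proof. by have := fdmulPl y k x 0; rewrite -[fdmul 0 y]/(0 * y) mul0r !addr0. Qed.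

Lemma fdscaleAr (k : K) (x y : A) : k *: (x * y) = x * (k *: y).
Proof. by have := fdmulPr x k y 0; rewrite -[fdmul x 0]/(x * 0) mulr0 !addr0. Qed.

End FinDimAlgebraRing.

Section FalgebraFinDim.
Variables (K : fieldType) (A : falgType K).

Lemma falg_mulPl (y : A) : linear ( *%R^~ y : A -> A).
Proof. by move=> k u v; rewrite mulrDl scalerAl. Qed.

Lemma falg_mulPr (x : A) : linear ( *%R x : A -> A).
Proof. by move=> k u v; rewrite mulrDr scalerAr. Qed.

HB.instance Definition _ := Vector_isFinDimAlgebra.Build K (Falgebra.sort A)
  (@mulrA A) (@mul1r A) (@mulr1 A) falg_mulPl falg_mulPr.

End FalgebraFinDim.

(* [A^c], the converse ring of ssralg, is the opposite algebra.               *)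
HB.instance Definition _ (K : fieldType) (V : vectType K) := Vector.on V^c.

Section Opposite.
Variables (K : fieldType) (A : finDimAlgType K).

Lemma opp_mulPl (y : A^c) : linear ( *%R^~ y : A^c -> A^c).
Proof. exact: (@fdmulPr K A). Qed.

Lemma opp_mulPr (x : A^c) : linear ( *%R x : A^c -> A^c).
Proof. exact: (@fdmulPl K A). Qed.

HB.instance Definition _ := Vector_isFinDimAlgebra.Build K A^c
  (@mulrA A^c) (@mul1r A^c) (@mulr1 A^c) opp_mulPl opp_mulPr.

End Opposite.

Definition bilinear_map (K : fieldType) (U V W : lmodType K)
    (f : U -> V -> W) : Prop :=
  (forall v, linear (f^~ v)) /\ (forall u, linear (f u)).

(* The tensor product of two finite-dimensional spaces, modelled by matrices  *)
(* of coordinates: [u ⊗ v] is the rank one matrix of the products of the      *)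
(* coordinates of [u] and [v]. The universal property is given by             *)
(* [pure_bilinear], [tlift_is_linear], [tlift_pure] and [tensor_ext] below.   *)
Section Tensor.
Import VectorInternalTheory.
Variable K : fieldType.
Implicit Types U V W : vectType K.

Definition tensor U V : Type := 'M[K]_(dim U, dim V).
HB.instance Definition _ U V := Vector.on (tensor U V).

Definition pure U V (u : U) (v : V) : tensor U V := (v2r u)^T *m v2r v.

(* On a basis; [r2v (delta_mx 0 i)] is the [i]-th basis vector.               *)
Definition tlift U V (W : lmodType K) (f : U -> V -> W) (t : tensor U V) : W :=
  \sum_i \sum_j t i j *: f (r2v (delta_mx 0 i)) (r2v (delta_mx 0 j)).

Lemma pure_linearl U V (v : V) : linear (fun u : U => pure u v).
Proof. by move=> k x y; rewrite /pure !linearP mulmxDl -scalemxAl. Qed.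

Lemma pure_linearr U V (u : U) : linear (@pure U V u).
Proof. by move=> k x y; rewrite /pure linearP mulmxDr -scalemxAr. Qed.

Lemma pure_bilinear U V : bilinear_map (@pure U V).
Proof. by split; [exact: pure_linearl | exact: pure_linearr]. Qed.

Lemma tlift_is_linear U V (W : lmodType K) (f : U -> V -> W) :
  linear (tlift f).
Proof.
move=> k x y; rewrite /tlift scaler_sumr -big_split; apply: eq_bigr => i _.
rewrite scaler_sumr -big_split; apply: eq_bigr => j _ /=.
by rewrite !mxE scalerDl scalerA.
Qed.

HB.instance Definition _ U V (W : lmodType K) (f : U -> V -> W) :=
  GRing.isLinear.Build K (tensor U V) W _ (tlift f) (tlift_is_linear f).

Lemma v2r_sum U (u : U) : u = \sum_i v2r u 0 i *: r2v (delta_mx 0 i).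
Proof.
rewrite -[LHS]v2rK {1}[v2r u]row_sum_delta linear_sum.
by apply: eq_bigr => i _; rewrite linearZ.
Qed.

Lemma tlift_pure U V (W : lmodType K) (f : U -> V -> W) u v :
  bilinear_map f -> tlift f (pure u v) = f u v.
Proof.
move=> [fl fr].
pose fL y : {linear U -> W} :=
  HB.pack (f^~ y) (GRing.isLinear.Build _ _ _ _ (f^~ y) (fl y)).
pose fR x : {linear V -> W} :=
  HB.pack (f x) (GRing.isLinear.Build _ _ _ _ (f x) (fr x)).
rewrite {2}[u]v2r_sum -[RHS]/(fL v _) linear_sum; apply: eq_bigr => i _.
rewrite linearZ /= {2}[v]v2r_sum -[f _ _]/(fR (r2v (delta_mx 0 i)) _).
rewrite linear_sum scaler_sumr; apply: eq_bigr => j _.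
by rewrite linearZ /= scalerA !mxE big_ord1 !mxE.
Qed.

Lemma tensor_ind U V (P : tensor U V -> Prop) :
  (forall u v, P (pure u v)) -> (forall x y, P x -> P y -> P (x + y)) ->
  forall t, P t.
Proof.
move=> Pp PD t.
have P0 : P 0.
  have -> : 0 = pure (0 : U) (0 : V) by rewrite /pure linear0 trmx0 mul0mx.
  exact: Pp.
rewrite [t]matrix_sum_delta; elim/big_ind: _ => // i _.
elim/big_ind: _ => // j _.
suff -> : t i j *: delta_mx i j
          = pure (t i j *: r2v (delta_mx 0 i)) (r2v (delta_mx 0 j)) by [].
rewrite /pure linearZ /= !r2vK linearZ /= -scalemxAl trmx_delta.
by rewrite mul_delta_mx.
Qed.

Lemma tensor_ext U V (W : lmodType K) (f g : {linear tensor U V -> W}) :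
  (forall u v, f (pure u v) = g (pure u v)) -> f =1 g.
Proof.
by move=> fg; elim/tensor_ind => // x y fgx fgy; rewrite !linearD fgx fgy.
Qed.

Lemma eq_tlift U V (W : lmodType K) (f g : U -> V -> W) :
  f =2 g -> tlift f =1 tlift g.
Proof.
by move=> fg t; apply: eq_bigr => i _; apply: eq_bigr => j _; rewrite fg.
Qed.

Lemma tliftP U V (W : lmodType K) k (f g : U -> V -> W) t :
  tlift (fun u v => k *: f u v + g u v) t = k *: tlift f t + tlift g t.
Proof.
rewrite /tlift scaler_sumr -big_split; apply: eq_bigr => i _.
rewrite scaler_sumr -big_split; apply: eq_bigr => j _ /=.
by rewrite scalerDr !scalerA mulrC.
Qed.

Lemma tlift_bilinear U V U' V' (W : lmodType K)
    (f : U -> V -> U' -> V' -> W) t :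
  (forall u' v', bilinear_map (fun u v => f u v u' v')) ->
  bilinear_map (fun u v => tlift (f u v) t).
Proof.
move=> fP; split=> [v|u] k x y /=; rewrite -tliftP; apply: eq_tlift => u' v'.
  by case: (fP u' v') => + _; apply.
by case: (fP u' v') => _; apply.
Qed.

Definition tmap U V U' V' (f : U -> U') (g : V -> V') :
    tensor U V -> tensor U' V' :=
  tlift (fun u v => pure (f u) (g v)).

HB.instance Definition _ U V U' V' (f : U -> U') (g : V -> V') :=
  GRing.Linear.on (tmap f g).

(* The canonical isomorphisms identifying (U ⊗ V) ⊗ W with U ⊗ (V ⊗ W), and   *)
(* K ⊗ U and U ⊗ K with U.                                                    *)
Definition tassoc U V W : tensor (tensor U V) W -> tensor U (tensor V W) :=
  tlift (fun t w => tlift (fun u v => pure u (pure v w)) t).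

Definition tunitl U : tensor K^o U -> U := tlift (fun (k : K^o) u => k *: u).
Definition tunitr U : tensor U K^o -> U := tlift (fun u (k : K^o) => k *: u).

Lemma tmap_pure U V U' V' (f : U -> U') (g : V -> V') u v :
  linear f -> linear g -> tmap f g (pure u v) = pure (f u) (g v).
Proof.
move=> fl gl; rewrite /tmap tlift_pure //; split=> [y|x] k a b /=.
  by rewrite fl pure_linearl.
by rewrite gl pure_linearr.
Qed.

Lemma tassoc_pure U V W (u : U) (v : V) (w : W) :
  tassoc (pure (pure u v) w) = pure u (pure v w).
Proof.
rewrite /tassoc tlift_pure.
  rewrite tlift_pure //; split=> [y|x] k a b /=.
    exact: pure_linearl.
  by rewrite pure_linearl pure_linearr.
split=> [y|x] k a b /=; first exact: linearP.
rewrite -tliftP; apply: eq_tlift => u' v'.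
by rewrite !pure_linearr.
Qed.

Lemma tunitl_pure U k (u : U) : tunitl (pure (k : K^o) u) = k *: u.
Proof.
rewrite /tunitl tlift_pure //; split=> [y|x] c a b /=.
  by rewrite scalerDl scalerA.
by rewrite scalerDr !scalerA mulrC.
Qed.

Lemma tunitr_pure U (u : U) k : tunitr (pure u (k : K^o)) = k *: u.
Proof.
rewrite /tunitr tlift_pure //; split=> [y|x] c a b /=.
  by rewrite scalerDr !scalerA mulrC.
by rewrite scalerDl scalerA.
Qed.

End Tensor.

Notation "U ⊗ V" := (tensor U V) : type_scope.
Notation "u ⊗ v" := (pure u v) : ring_scope.

Section PureTheory.
Variables (K : fieldType) (U V : vectType K).
Implicit Types (k : K) (u x : U) (v y : V).

Lemma pureDl u x v : (u + x) ⊗ v = u ⊗ v + x ⊗ v.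
Proof. by have := pure_linearl v 1 u x; rewrite !scale1r. Qed.

Lemma pureDr u v y : u ⊗ (v + y) = u ⊗ v + u ⊗ y.
Proof. by have := pure_linearr u 1 v y; rewrite !scale1r. Qed.

Lemma pureZl k u v : (k *: u) ⊗ v = k *: (u ⊗ v).
Proof.
have := pure_linearl v (k - 1) u u.
by rewrite scalerBl scale1r subrK scalerBl scale1r subrK.
Qed.

Lemma pureZr k u v : u ⊗ (k *: v) = k *: (u ⊗ v).
Proof.
have := pure_linearr u (k - 1) v v.
by rewrite scalerBl scale1r subrK scalerBl scale1r subrK.
Qed.

End PureTheory.

(* The algebra A ⊗ B, with (a ⊗ b)(a' ⊗ b') = aa' ⊗ bb'.                      *)
Section TensorAlgebra.
Variables (K : fieldType) (A B : finDimAlgType K).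

Definition tensor_mul (x y : A ⊗ B) : A ⊗ B :=
  tlift (fun (a : A) (b : B) =>
    tlift (fun (a' : A) (b' : B) => (a * a') ⊗ (b * b')) y) x.

Lemma tensor_mul_pure (a a' : A) (b b' : B) :
  tensor_mul (a ⊗ b) (a' ⊗ b') = (a * a') ⊗ (b * b').
Proof.
rewrite /tensor_mul tlift_pure.
  rewrite tlift_pure //; split=> [y|x] k u v /=.
    by rewrite mulrDr -fdscaleAr pureDl pureZl.
  by rewrite mulrDr -fdscaleAr pureDr pureZr.
apply: tlift_bilinear => u' v'; split=> [y|x] k u v /=.
  by rewrite mulrDl -fdscaleAl pureDl pureZl.
by rewrite mulrDl -fdscaleAl pureDr pureZr.
Qed.

Lemma tensor_mulPl (y : A ⊗ B) : linear (tensor_mul^~ y).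
Proof. by move=> k u v; rewrite /tensor_mul linearP. Qed.

Lemma tensor_mulPr (x : A ⊗ B) : linear (tensor_mul x).
Proof.
move=> k u v; rewrite /tensor_mul -tliftP; apply: eq_tlift => a b.
by rewrite linearP.
Qed.

Lemma tensor_mulDl : left_distributive tensor_mul +%R.
Proof. by move=> x y z; have := tensor_mulPl z 1 x y; rewrite !scale1r. Qed.

Lemma tensor_mulDr : right_distributive tensor_mul +%R.
Proof. by move=> x y z; have := tensor_mulPr x 1 y z; rewrite !scale1r. Qed.

Lemma tensor_mulA : associative tensor_mul.
Proof.
move=> x y z; elim/tensor_ind: x => [a b|x x' IH IH']; last first.
  by rewrite !tensor_mulDl IH IH'.
elim/tensor_ind: y => [a' b'|y y' IH IH']; last first.
  by rewrite !(tensor_mulDl, tensor_mulDr) IH IH'.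
elim/tensor_ind: z => [a'' b''|z z' IH IH']; last first.
  by rewrite !tensor_mulDr IH IH'.
by rewrite !tensor_mul_pure !mulrA.
Qed.

Lemma tensor_mul1l : left_id ((1 : A) ⊗ (1 : B)) tensor_mul.
Proof.
elim/tensor_ind => [a b|x y IHx IHy]; last by rewrite tensor_mulDr IHx IHy.
by rewrite tensor_mul_pure !mul1r.
Qed.

Lemma tensor_mul1r : right_id ((1 : A) ⊗ (1 : B)) tensor_mul.
Proof.
elim/tensor_ind => [a b|x y IHx IHy]; last by rewrite tensor_mulDl IHx IHy.
by rewrite tensor_mul_pure !mulr1.
Qed.

HB.instance Definition _ := Vector_isFinDimAlgebra.Build K (A ⊗ B)%type
  tensor_mulA tensor_mul1l tensor_mul1r tensor_mulPl tensor_mulPr.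
HB.instance Definition _ := GRing.Zmodule_isPzRing.Build (A ⊗ B)%type
  tensor_mulA tensor_mul1l tensor_mul1r tensor_mulDl tensor_mulDr.

Lemma mul_pure (a a' : A) (b b' : B) :
  (a ⊗ b) * (a' ⊗ b') = (a * a') ⊗ (b * b').
Proof. exact: tensor_mul_pure. Qed.

End TensorAlgebra.

Section Frobenius.
Variables (K : fieldType) (A : finDimAlgType K).

(* A^* as a left A-module.                                                    *)
Definition dual : Type := 'Hom(A, K^o).
HB.instance Definition _ := GRing.Zmodule.on dual.

Definition dual_scale (a : A) (z : dual) : dual :=
  linfun ((z : 'Hom(A, K^o)) \o *%R^~ a).

Lemma rmul_linear (a : A) : linear ( *%R^~ a : A -> A).
Proof. by move=> k x y; rewrite mulrDl fdscaleAl. Qed.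

Lemma dual_scaleE (a : A) (z : dual) (b : A) :
  (dual_scale a z : 'Hom(A, K^o)) b = (z : 'Hom(A, K^o)) (b * a).
Proof.
pose f : {linear A -> A} :=
  HB.pack ( *%R^~ a) (GRing.isLinear.Build _ _ _ _ _ (rmul_linear a)).
by rewrite /dual_scale -[ *%R^~ a]/(f : A -> A) lfunE.
Qed.

Lemma dual_scaleA a b z : dual_scale a (dual_scale b z) = dual_scale (a * b) z.
Proof. by apply/lfunP=> x; rewrite !dual_scaleE mulrA. Qed.

Lemma dual_scale1 : left_id 1 dual_scale.
Proof. by move=> z; apply/lfunP=> x; rewrite dual_scaleE mulr1. Qed.

Lemma dual_scaleDr : right_distributive dual_scale +%R.
Proof.
move=> a z w; apply/lfunP=> x.
by rewrite dual_scaleE (add_lfunE z w) (add_lfunE (dual_scale a z))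
           !dual_scaleE.
Qed.

Lemma dual_scaleDl z : {morph dual_scale^~ z : a b / a + b}.
Proof.
move=> a b; apply/lfunP=> x.
by rewrite (add_lfunE (dual_scale a z)) !dual_scaleE mulrDr linearD.
Qed.

HB.instance Definition _ := GRing.Zmodule_isLmodule.Build A dual
  dual_scaleA dual_scale1 dual_scaleDr dual_scaleDl.

(* [A^o] is the left regular module. An A-linear map is K-linear.             *)
Definition frobenius_algebra : Prop :=
  exists lambda_L : {linear A^o -> dual}, bijective lambda_L.

End Frobenius.

(* A^e, and the left A^e-modules A and A ⊗ A. The latter two are renamed to   *)
(* keep the A^e-actions apart from the K-linear and multiplicative structures. *)
Notation enveloping A := (A ⊗ A^c)%type.

Section Bimodules.
Variables (K : fieldType) (A : finDimAlgType K).
Local Notation Ae := (enveloping A).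

Definition env_A : Type := A.
HB.instance Definition _ := GRing.Zmodule.on env_A.

Definition env_AA : Type := A ⊗ A.
HB.instance Definition _ := GRing.Zmodule.on env_AA.

Definition env_scale (z : Ae) (a : env_A) : env_A :=
  tlift (fun (b : A) (b' : A^c) => b * (a : A) * (b' : A)) z.

Definition env_scale2 (z : Ae) (t : env_AA) : env_AA :=
  tlift (fun (b : A) (b' : A^c) =>
    tmap (fun x : A => b * x) (fun y : A => y * (b' : A)) t) z.

Lemma env_scale_pure (b : A) (b' : A^c) (a : env_A) :
  env_scale (b ⊗ b') a = b * (a : A) * (b' : A).
Proof.
rewrite /env_scale tlift_pure //; split=> [y|x] k u v /=.
  by rewrite !mulrDl -!fdscaleAl.
by rewrite mulrDr -fdscaleAr.
Qed.

Lemma env_scale2_pure (b : A) (b' : A^c) (x y : A) :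
  env_scale2 (b ⊗ b') (x ⊗ y) = (b * x) ⊗ (y * (b' : A)).
Proof.
rewrite /env_scale2 tlift_pure; first rewrite tmap_pure // => k u v.
- by rewrite mulrDr fdscaleAr.
- by rewrite mulrDl fdscaleAl.
apply: tlift_bilinear => u' v'; split=> [c|c] k u v /=.
  by rewrite mulrDl -fdscaleAl pureDl pureZl.
by rewrite mulrDr -fdscaleAr pureDr pureZr.
Qed.

Lemma env_scaleDl a : {morph env_scale^~ a : z w / z + w}.
Proof. by move=> z w; rewrite /env_scale linearD. Qed.

Lemma env_scale2Dl t : {morph env_scale2^~ t : z w / z + w}.
Proof. by move=> z w; rewrite /env_scale2 linearD. Qed.

Lemma env_scaleDr : right_distributive env_scale +%R.
Proof.
move=> z a b; elim/tensor_ind: z => [c c'|z w IHz IHw].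
  by rewrite !env_scale_pure mulrDr mulrDl.
by rewrite !env_scaleDl IHz IHw addrACA.
Qed.

Lemma env_scale2Dr : right_distributive env_scale2 +%R.
Proof.
move=> z s t; rewrite /env_scale2 -[X in _ = X + _]scale1r -tliftP.
by apply: eq_tlift => b b'; rewrite scale1r linearD.
Qed.

Lemma env_scaleA z w a : env_scale z (env_scale w a) = env_scale (z * w) a.
Proof.
elim/tensor_ind: z => [b b'|z z' IH IH']; last first.
  by rewrite mulrDl !env_scaleDl IH IH'.
elim/tensor_ind: w => [c c'|w w' IH IH']; last first.
  by rewrite mulrDr !env_scaleDl env_scaleDr IH IH'.
by rewrite mul_pure !env_scale_pure !mulrA.
Qed.

Lemma env_scale2A z w t : env_scale2 z (env_scale2 w t) = env_scale2 (z * w) t.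
Proof.
elim/tensor_ind: z => [b b'|z z' IH IH']; last first.
  by rewrite mulrDl !env_scale2Dl IH IH'.
elim/tensor_ind: w => [c c'|w w' IH IH']; last first.
  by rewrite mulrDr !env_scale2Dl env_scale2Dr IH IH'.
elim/tensor_ind: t => [x y|s t IH IH']; last first.
  by rewrite !env_scale2Dr IH IH'.
by rewrite mul_pure !env_scale2_pure !mulrA.
Qed.

Lemma env_scale1 : left_id 1 env_scale.
Proof. by move=> a; rewrite env_scale_pure mul1r mulr1. Qed.

Lemma env_scale21 : left_id 1 env_scale2.
Proof.
elim/tensor_ind => [x y|s t IHs IHt]; last by rewrite env_scale2Dr IHs IHt.
by rewrite env_scale2_pure mul1r mulr1.
Qed.

HB.instance Definition _ := GRing.Zmodule_isLmodule.Build Ae env_A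
  env_scaleA env_scale1 env_scaleDr env_scaleDl.
HB.instance Definition _ := GRing.Zmodule_isLmodule.Build Ae env_AA
  env_scale2A env_scale21 env_scale2Dr env_scale2Dl.

Definition env_linear (delta : A -> A ⊗ A) : Prop :=
  linear (delta : env_A -> env_AA).

Definition coassociative (delta : A -> A ⊗ A) : Prop :=
  forall a, tassoc (tmap delta id (delta a)) = tmap id delta (delta a).

Definition counital (delta : A -> A ⊗ A) : Prop :=
  exists epsilon : {linear A -> K^o},
    (forall a, tunitl (tmap epsilon id (delta a)) = a) /\
    (forall a, tunitr (tmap id epsilon (delta a)) = a).

End Bimodules.

(* Main.v *)
Require Import Defs.
From HB Require Import structures.
From mathcomp Require Import all_boot all_order all_algebra.

(* A left A-linear isomorphism λ : A -> A^* amounts to the form                *)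
(* (b, a) |-> ε (b a), with ε := λ 1, being nondegenerate. Given λ, dual bases *)
(* e_i, e^i for this form yield the Casimir element c := Σ e^i ⊗ e_i, which    *)
(* satisfies b c = c b, and δ b := b c is the comultiplication, with counit ε. *)
(* Conversely, given δ and ε, write δ 1 = Σ x_i ⊗ y_i; then                    *)
(* ζ |-> Σ ζ(y_i) x_i is inverse to a |-> (b |-> ε (b a)).                     *)

Set Implicit Arguments.
Unset Strict Implicit.
Unset Printing Implicit Defensive.
Import GRing.Theory.
Local Open Scope ring_scope.

(** An [A^e]-linear δ satisfies δ (x y) = x (δ 1) y, so it is determined by δ 1, and all the axioms
    become statements about a finite expansion of δ 1 into pure tensors ([tensor_sum_pure]).
    Coassociativity follows from the two ways to write δ x, as x (δ 1) and as (δ 1) x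
    ([env_linear_coassociative]). The two counit identities say that the legs of δ 1 are dual
    families for the form ε (b a), which links counits to the bijectivity of λ in both
    directions. *)

Lemma tensor_sum_pure (K : fieldType) (U V : vectType K) (t : (U ⊗ V)%type) :
  exists s : seq (U * V), t = \sum_(p <- s) p.1 ⊗ p.2.
Proof.
elim/tensor_ind: t => [u v|_ _ [s ->] [s' ->]].
  by exists [:: (u, v)]; rewrite big_seq1.
by exists (s ++ s'); rewrite big_cat.
Qed.

Lemma pure0l (K : fieldType) (U V : vectType K) (v : V) : (0 : U) ⊗ v = 0.
Proof. by have := pureZl 0 (0 : U) v; rewrite !scale0r. Qed.

Lemma pure0r (K : fieldType) (U V : vectType K) (u : U) : u ⊗ (0 : V) = 0.
Proof. by have := pureZr 0 u (0 : V); rewrite !scale0r. Qed.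

Lemma pure_suml (K : fieldType) (U V : vectType K) I (r : seq I)
    (F : I -> U) (v : V) :
  (\sum_(i <- r) F i) ⊗ v = \sum_(i <- r) F i ⊗ v.
Proof.
elim: r => [|i r IH]; last by rewrite !big_cons pureDl IH.
by rewrite !big_nil pure0l.
Qed.

Lemma pure_sumr (K : fieldType) (U V : vectType K) I (r : seq I)
    (F : I -> V) (u : U) :
  u ⊗ (\sum_(i <- r) F i) = \sum_(i <- r) u ⊗ F i.
Proof.
elim: r => [|i r IH]; last by rewrite !big_cons pureDr IH.
by rewrite !big_nil pure0r.
Qed.

Lemma tmap_sum_pure (K : fieldType) (U V U' V' : vectType K)
    (f : U -> U') (g : V -> V') I (r : seq I) (F : I -> U) (G : I -> V) :
  linear f -> linear g ->
  tmap f g (\sum_(i <- r) F i ⊗ G i) = \sum_(i <- r) f (F i) ⊗ g (G i).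
Proof.
by move=> fl gl; rewrite linear_sum; apply: eq_bigr => i _; exact: tmap_pure.
Qed.

HB.instance Definition _ (K : fieldType) (U V W : vectType K) :=
  GRing.Linear.on (@tassoc K U V W).
HB.instance Definition _ (K : fieldType) (U : vectType K) :=
  GRing.Linear.on (@tunitl K U).
HB.instance Definition _ (K : fieldType) (U : vectType K) :=
  GRing.Linear.on (@tunitr K U).

Section Bimodule.
Variables (K : fieldType) (A : finDimAlgType K).

Lemma env_scale2_sum (b b' : A) I (r : seq I) (F G : I -> A) :
  env_scale2 (b ⊗ (b' : A^c)) (\sum_(i <- r) F i ⊗ G i) =
  \sum_(i <- r) (b * F i) ⊗ (G i * b').
Proof.
elim: r => [|i r IH].
  rewrite !big_nil -[X in env_scale2 _ X](pure0l A (0 : A)) env_scale2_pure.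
  by rewrite mulr0 pure0l.
by rewrite !big_cons env_scale2Dr env_scale2_pure IH.
Qed.

Lemma env_linear_mul (delta : A -> (A ⊗ A)%type) (b a b' : A) :
  env_linear delta -> delta 0 = 0 ->
  delta (b * a * b') = env_scale2 (b ⊗ (b' : A^c)) (delta a).
Proof.
move=> dl d0; have := dl (b ⊗ (b' : A^c)) a 0.
rewrite !addr0 -[(_ *: _ : env_A A)]/(env_scale _ _) env_scale_pure => ->.
by rewrite d0 addr0.
Qed.

(** With δ 1 = Σ x_p ⊗ y_p, both sides equal the double sum of a x_q ⊗ y_q x_p ⊗ y_p. The middle
    factor arises on one side from (δ 1) x_p, on the other from y_p (δ 1). *)
Lemma env_linear_coassociative (delta : {linear A -> (A ⊗ A)%type}) :
  env_linear delta -> coassociative delta.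
Proof.
move=> dl a.
have dM b x b' := env_linear_mul b x b' dl (linear0 delta).
have [s d1] := tensor_sum_pure (delta 1).
have dlE x : delta x = \sum_(p <- s) (x * p.1) ⊗ p.2.
  rewrite -[x in LHS]mulr1 -[x * 1]mulr1 dM d1 env_scale2_sum.
  by apply: eq_bigr => p _; rewrite mulr1.
have dx (x y : A) : delta (x * y) = \sum_(p <- s) (x * p.1) ⊗ (p.2 * y).
  rewrite -[x]mulr1 dM d1 env_scale2_sum.
  by apply: eq_bigr => p _; rewrite mulr1.
have lid : linear (id : A -> A) by [].
have ldelta : linear delta by exact: linearP.
rewrite dlE !tmap_sum_pure // linear_sum.
under eq_bigr => p _ do rewrite dx pure_suml linear_sum.
under [RHS]eq_bigr => p _ do rewrite dlE pure_sumr.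
rewrite exchange_big; apply: eq_bigr => p _; apply: eq_bigr => q _.
exact: tassoc_pure.
Qed.

End Bimodule.

Lemma frobenius_comultiplication (K : fieldType) (A : finDimAlgType K) :
  frobenius_algebra A ->
  exists delta : {linear A -> (A ⊗ A)%type},
    [/\ coassociative delta, counital delta & env_linear delta].
Proof.
case=> lam [mu lamK muK].
(* By [A]-linearity λ a = a · λ 1, so λ is determined by the functional λ 1. *)
have [eps lamE] : exists eps : 'Hom(A, K^o),
    forall a b : A, (lam a : 'Hom(A, K^o)) b = eps (b * a).
  exists (lam 1) => a b; rewrite -dual_scaleE.
  rewrite -[dual_scale _ _]/(a *: lam 1) -linearZ.
  by rewrite [in RHS]/GRing.scale /= mulr1.
pose e := vbasis {:A}.
pose n := \dim {:A}.
(* The dual basis consists of the preimages under λ of the coordinate functionals. *)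
pose f (i : 'I_n) : A := mu (linfun (coord e i : {linear A -> K^o})).
have fE (b : A) i : eps (b * f i) = coord e i b.
  by rewrite -lamE /f muK lfunE.
have eE (b : A) : b = \sum_(i < n) eps (b * f i) *: e`_i.
  by rewrite {1}(coord_vbasis (memvf b)); under [RHS]eq_bigr do rewrite fE.
(* As λ is injective, it suffices to compare ε (x b) with its expansion for every x. *)
have fE' (b : A) : b = \sum_(i < n) (eps (e`_i * b) : K) *: f i.
  apply: (can_inj lamK); apply/lfunP => x; rewrite !lamE.
  rewrite {1}(eE x) mulr_suml mulr_sumr !linear_sum; apply: eq_bigr => i _.
  by rewrite -fdscaleAl -fdscaleAr !linearZ /= /GRing.scale /= mulrC.
(* This is b' c = c b' for the Casimir element c: expand [e_i b'] in the basis [e], swap the sums,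
   and recognise the expansion of [b' f_j] in [f]. *)
have comm (b b' : A) :
    \sum_(i < n) (b * b' * f i) ⊗ e`_i = \sum_(i < n) (b * f i) ⊗ (e`_i * b').
  under [RHS]eq_bigr => i _ do rewrite (eE (e`_i * b')) pure_sumr.
  rewrite exchange_big; apply: eq_bigr => i _ /=.
  rewrite -mulrA {1}(fE' (b' * _)) mulr_sumr pure_suml.
  by apply: eq_bigr => j _; rewrite -fdscaleAr pureZl pureZr mulrA.
pose d (a : A) := \sum_(i < n) (a * f i) ⊗ e`_i.
have dlin : linear d.
  move=> k x y; rewrite /d scaler_sumr -big_split; apply: eq_bigr => i _ /=.
  by rewrite mulrDl -fdscaleAl pureDl pureZl.
pose delta : {linear A -> (A ⊗ A)%type} :=
  HB.pack d (GRing.isLinear.Build _ _ _ _ d dlin).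
have denv : env_linear delta.
  move=> z x y; rewrite -[LHS]/(d _) -[RHS]/(env_scale2 z (d x) + d y).
  rewrite -[(z *: x : env_A A)]/(env_scale z x).
  have dD u v : d (u + v) = d u + d v by exact: (raddfD delta).
  rewrite [LHS]dD; congr (_ + _).
  (* On pure tensors, left factors pass through [d] by definition and right factors by [comm]. *)
  elim/tensor_ind: z => [b b'|z w IHz IHw].
    rewrite env_scale_pure {2}/d env_scale2_sum /d comm.
    by under [RHS]eq_bigr do rewrite mulrA.
  by rewrite env_scaleDl env_scale2Dl [LHS]dD IHz IHw.
exists delta; split=> //; first exact: env_linear_coassociative.
exists eps.
have leps : linear eps by exact: linearP.
have lid : linear (id : A -> A) by [].
split=> a.
  rewrite -[delta a]/(d a) /d tmap_sum_pure // linear_sum [RHS]eE.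
  by apply: eq_bigr => i _; exact: tunitl_pure.
(* Moving [a] to the right leg by [comm] leaves the sum of ε (e_i a) f_i, which [fE'] evaluates. *)
rewrite -[delta a]/(d a) /d -[a]mul1r comm tmap_sum_pure // linear_sum mul1r.
by rewrite [RHS]fE'; apply: eq_bigr => i _; rewrite mul1r; exact: tunitr_pure.
Qed.

(** Each counit identity accounts for one of the two composites of λ with its candidate inverse. *)
Lemma comultiplication_frobenius (K : fieldType) (A : finDimAlgType K)
    (delta : {linear A -> (A ⊗ A)%type}) :
  counital delta -> env_linear delta -> frobenius_algebra A.
Proof.
move=> [eps [epsl epsr]] dl.
have dM b x b' := env_linear_mul b x b' dl (linear0 delta).
have [s d1] := tensor_sum_pure (delta 1).
have leps : linear eps by exact: linearP.
have lid : linear (id : A -> A) by [].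
(* Apply id ⊗ ε to δ a = (δ 1) a; for [lE] below, apply ε ⊗ id to δ a = a (δ 1). *)
have rE (a : A) : \sum_(p <- s) (eps (p.2 * a) : K) *: p.1 = a.
  rewrite -[RHS]epsr -[a in RHS]mul1r -[1 in RHS]mulr1 dM d1 env_scale2_sum.
  rewrite tmap_sum_pure // linear_sum; apply: eq_bigr => p _.
  by rewrite mul1r; apply/esym/tunitr_pure.
have lE (a : A) : \sum_(p <- s) (eps (a * p.1) : K) *: p.2 = a.
  rewrite -[RHS]epsl -[a in RHS]mulr1 -[a * 1]mulr1 dM d1 env_scale2_sum.
  rewrite tmap_sum_pure // linear_sum; apply: eq_bigr => p _.
  by rewrite mulr1; apply/esym/tunitl_pure.
pose lam (a : A^o) : dual A := dual_scale a (linfun eps).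
have lamE (a b : A) : (lam a : 'Hom(A, K^o)) b = eps (b * a).
  by rewrite dual_scaleE lfunE.
have lamlin : linear lam.
  move=> c x y; rewrite /lam dual_scaleDl; congr (_ + _).
  by rewrite -[RHS]/(dual_scale c (dual_scale x _)) dual_scaleA.
pose Lam : {linear A^o -> dual A} :=
  HB.pack lam (GRing.isLinear.Build _ _ _ _ lam lamlin).
exists Lam.
exists (fun z : dual A => \sum_(p <- s) ((z : 'Hom(A, K^o)) p.2 : K) *: p.1).
  by move=> a; rewrite -[RHS]rE; apply: eq_bigr => p _; rewrite lamE.
(* By linearity, Σ ζ(y_p) ε (b x_p) is ζ applied to Σ ε (b x_p) y_p, which is b by [lE]. *)
move=> z; apply/lfunP => b; rewrite lamE.
rewrite -[b in RHS]lE mulr_sumr !linear_sum; apply: eq_bigr => p _.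
by rewrite -fdscaleAr !linearZ /= /GRing.scale /= mulrC.
Qed.

Theorem theorem2p1 (K : fieldType) (A : finDimAlgType K) :
  frobenius_algebra A <->
  exists delta : {linear A -> (A ⊗ A)%type},
    [/\ coassociative delta, counital delta & env_linear delta].
Proof.
split; first exact: frobenius_comultiplication.
by case=> delta [_ cu dl]; apply: comultiplication_frobenius cu dl.
Qed.
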